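(* For every integer $k\geq 2$, the leading coefficient of $P_k(x)$ is $$A_{k-1}\,2^{k-2}.$$
   Context: The polynomials $P_k(x)$, $k\ge 1$, are defined recursively by $P_1(x)=1$ and, for $k\ge 1$, $$P_{k+1}(x) = \frac{P_k(k)\prod_{i=1}^{k}(2x-2k+2i+1)-\left(\prod_{i=1}^{k}(2i+1)\right)P_k(x)}{2x-2k};$$ this is a polynomial because the numerator vanishes at $x=k$ (the quotient is taken as polynomials in $x$). For $k\ge 1$, $A_k=P_k(k)$. *)

(* Defs.v *)
From mathcomp Require Import all_boot all_order all_algebra.
Set Implicit Arguments.
Unset Strict Implicit.
Unset Printing Implicit Defensive.
Import Order.TTheory GRing.Theory Num.Theory.
Local Open Scope ring_scope.

Definition P_num (k : nat) (p : {poly rat}) : {poly rat} :=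
  p.[k%:R] *: \prod_(1 <= i < k.+1) (2%:R *: 'X - (2 * k)%:R + (2 * i)%:R + 1)
  - (\prod_(1 <= i < k.+1) (2 * i + 1)%:R) *: p.

Definition P_den (k : nat) : {poly rat} := 2%:R *: 'X - (2 * k)%:R.

(* The family is indexed from k = 1; the value [P 0 = 0] is junk. The Euclidean
   quotient [%/] is exact here, see [P_rec]. *)
Fixpoint P (k : nat) : {poly rat} :=
  match k with
  | 0 => 0
  | k'.+1 => if k' == 0%N then 1 else P_num k' (P k') %/ P_den k'
  end.

Definition A (k : nat) : rat := (P k).[k%:R].

Lemma P_den_dvd_num (k : nat) (p : {poly rat}) : P_den k %| P_num k p.
Proof.
have -> : P_den k = 2%:R *: ('X - (k%:R)%:P).
  by rewrite /P_den scalerBr natrM -!mul_polyC !polyC_natr.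
rewrite dvdpZl ?pnatr_eq0 // dvdp_XsubCl rootE /P_num !hornerE horner_prod.
rewrite mulrC -mulrBl mulf_eq0 subr_eq0; apply/orP; left; apply/eqP.
apply: eq_bigr => i _; rewrite !hornerE -!polyC_natr !hornerE.
by rewrite -natrM subrr add0r natrD.
Qed.

Lemma P_rec (k : nat) : (0 < k)%N -> P k.+1 * P_den k = P_num k (P k).
Proof. by case: k => // k _; rewrite [P k.+2]/= divpK ?P_den_dvd_num. Qed.

(* Main.v *)
Require Import Defs.
From mathcomp Require Import all_boot all_order all_algebra.
From mathcomp Require Import ring lra zify.
Import Order.TTheory GRing.Theory Num.Theory.
Local Open Scope ring_scope.

(** In the recursion, the product in the numerator has degree k and leading
coefficient 2^k, while P_k has degree less than k by induction. So if A_k is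
nonzero, the numerator has leading coefficient A_k 2^k, and dividing by
2 x - 2 k gives P_{k+1} the leading coefficient A_k 2^(k-1)
([size_lead_P]). If A_k vanished the top terms would disappear, and the
leading coefficient could be governed by P_k instead; the content of the proof
is therefore that A_k is never zero. In fact it is positive ([A_gt0]).

Write c_k for the product of the odd numbers 3, 5, ..., 2 k + 1 and
d_k = c_1 ... c_{k-1}. Evaluated at an integer n > k and normalised by suitable
factors, the recursion becomes a telescoping relation; summing it from k = 1 up
to k = n, where P_n (n) = A_n, gives ([coth_coef_conv])

  sum_{j <= n} v_j / (2 (n - j) + 1)! = n / (2 n + 1)!,
  where v_0 = 0 and v_j = (-1)^(j-1) A_j / (2 d_{j+1}).

With S = sum_n z^n / (2 n + 1)! = sinh (sqrt z) / sqrt z and D = z d/dz, this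
says V S = D S for V = sum_n v_n z^n. Hence V = (sqrt z coth (sqrt z) - 1) / 2
and v_n = 2^(2 n - 1) B_{2n} / (2 n)! with B_{2n} a Bernoulli number, so the
positivity of A_n is the alternation of signs of the Bernoulli numbers. That
follows from the Riccati equation of the hyperbolic cotangent,
D V + V^2 + V / 2 = z / 4 ([riccati]): comparing coefficients expresses
(n + 1/2) v_n for n > 1 as minus a sum of products v_i v_{n-i} all having the
same sign ([riccati_alternating]). The power series are handled as polynomials
modulo a power of X. *)

(** * Polynomials modulo a power of X *)

(** The Euler operator: unlike the derivative itself, it preserves
divisibility by each power of X, so it acts on truncated power series. *)
Definition Xderiv (p : {poly rat}) : {poly rat} := 'X * p^`().

Lemma coef_Xderiv (p : {poly rat}) n : (Xderiv p)`_n = n%:R * p`_n.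
Proof.
rewrite /Xderiv coefXM; case: n => [|n] /=; first by rewrite mul0r.
by rewrite coef_deriv mulr_natl.
Qed.

Lemma dvdXnP (p : {poly rat}) M :
  (forall i, (i < M)%N -> p`_i = 0) <-> 'X^M %| p.
Proof.
split=> [p0|/dvdpP[q ->] i ltiM]; last by rewrite coefMXn ltiM.
have /eqP := poly_take_drop M p; rewrite eq_sym => /eqP ->.
suff -> : take_poly M p = 0 by rewrite add0r dvdp_mull.
by apply/polyP=> i; rewrite coef_take_poly coef0; case: ifP => // /p0.
Qed.

Lemma dvdXn_Xderiv M (p : {poly rat}) : 'X^M %| p -> 'X^M %| Xderiv p.
Proof.
move=> /dvdXnP p0; apply/dvdXnP => i ltiM.
by rewrite coef_Xderiv p0 ?mulr0.
Qed.

(** * The hyperbolic cotangent and its Riccati equation *)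

(** The coefficients of sinh (sqrt z) / sqrt z. *)
Definition sinh_coef (n : nat) : rat := (((2 * n).+1)`!)%:R^-1.

Lemma sinh_coef_neq0 n : sinh_coef n != 0.
Proof. by rewrite invr_eq0 pnatr_eq0 -lt0n fact_gt0. Qed.

(** The coefficient form of the differential equation
4 D^2 S + 2 D S = z S, with D = z d/dz, of S = sinh (sqrt z) / sqrt z. *)
Lemma sinh_coefS n :
  (4 * n.+1 * n.+1 + 2 * n.+1)%:R * sinh_coef n.+1 = sinh_coef n.
Proof.
rewrite /sinh_coef; set m := (2 * n).+1.
have -> : (2 * n.+1).+1 = m.+2 by rewrite /m; lia.
have -> : (4 * n.+1 * n.+1 + 2 * n.+1 = m.+2 * m.+1)%N by rewrite /m; lia.
move: (m) => {}m.
have m0 : ((m`!)%:R : rat) != 0 by rewrite pnatr_eq0 -lt0n fact_gt0.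
rewrite !factS !natrM; field.
by rewrite m0 -(natrD _ 1) -(natrD _ 2) !pnatr_eq0.
Qed.

(** If V S = D S then D V * S = D (D S) - V * D S = D (D S) - V^2 S, and the
second order equation of S rewrites D (D S) as z S / 4 - V S / 2. Cancelling S,
whose constant term is nonzero, leaves D V + V^2 + V / 2 = z / 4. *)
Lemma riccati (v : nat -> rat) :
    v 0%N = 0 ->
    (forall n, \sum_(i < n.+1) v i * sinh_coef (n - i) = n%:R * sinh_coef n) ->
  forall n, (n%:R + 2^-1) * v n + \sum_(i < n.+1) v i * v (n - i)%N
            = (n == 1)%:R * 4^-1.
Proof.
move=> v0 vE n; set M := n.+1.
pose S := \poly_(i < M) sinh_coef i; pose V := \poly_(i < M) v i.
have coefS i : (i < M)%N -> S`_i = sinh_coef i by rewrite coef_poly => ->.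
have coefV i : (i < M)%N -> V`_i = v i by rewrite coef_poly => ->.
pose E1 := V * S - Xderiv S.
pose E2 := Xderiv (Xderiv S) - 4^-1 *: ('X * S) + 2^-1 *: Xderiv S.
pose E := Xderiv V + V ^+ 2 + 2^-1 *: V - 4^-1 *: 'X.
have dE1 : 'X^M %| E1.
  apply/dvdXnP => i ltiM; rewrite coefB coef_Xderiv coefM coefS // -vE.
  rewrite (eq_bigr (fun j : 'I_i.+1 => v j * sinh_coef (i - j))) ?subrr //.
  move=> j _; have lej := ltn_ord j; rewrite coefV ?coefS //; lia.
have dE2 : 'X^M %| E2.
  apply/dvdXnP => i ltiM; rewrite coefD coefB !coefZ !coef_Xderiv coefXM.
  case: i ltiM => [|i] ltiM /=; first by rewrite !mul0r !mulr0 subr0 addr0.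
  rewrite !coefS ?(ltnW ltiM) // -(sinh_coefS i) natrD !natrM; by field.
(* E1 and E2 are the errors left by truncation in V S = D S and in the
   equation of S; D E1 accounts for the product rule. *)
have dES : 'X^M %| E * S.
  have -> : E * S = Xderiv E1 + V * E1 + 2^-1 *: E1 + E2.
    rewrite /E /E2 /E1 /Xderiv !derivE -!mul_polyC; ring.
  apply: dvdp_add dE2; rewrite !dvdp_add ?dvdXn_Xderiv ?dvdp_mull //.
  by rewrite -mul_polyC dvdp_mull.
(* X does not divide S, so S can be cancelled modulo X^M. *)
have coXS : coprimep 'X^M S.
  rewrite coprimep_expl // coprimep_sym -['X]subr0 -polyC0 coprimep_XsubC.
  by rewrite rootE horner_coef0 coefS // sinh_coef_neq0.
move: dES; rewrite Gauss_dvdpl // => /dvdXnP/(_ n (ltnSn n)).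
rewrite coefB !coefD !coefZ coef_Xderiv coefV // coefX expr2 coefM.
rewrite (eq_bigr (fun i : 'I_n.+1 => v i * v (n - i)%N)); last first.
  move=> j _; have lej := ltn_ord j; rewrite !coefV //; lia.
by move/eqP; rewrite subr_eq0 [X in _ == X]mulrC => /eqP <-; ring.
Qed.

(** For n > 1 the terms i = 0 and i = n of the sum vanish, and by induction each
remaining v_i v_(n-i) has the sign (-1)^(i-1) (-1)^(n-i-1) = (-1)^n, opposite
to the sign claimed for v_n. *)
Lemma riccati_alternating (v : nat -> rat) :
    v 0%N = 0 ->
    (forall n, (n%:R + 2^-1) * v n + \sum_(i < n.+1) v i * v (n - i)%N
               = (n == 1)%:R * 4^-1) ->
  forall n, (0 < n)%N -> 0 < (-1) ^+ n.-1 * v n.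
Proof.
move=> v0 vE; elim/ltn_ind=> -[|[|n]] // IH _.
  by have := vE 1%N; rewrite !big_ord_recl big_ord0 /= v0; lra.
have := vE n.+2.
rewrite mul0r big_ord_recl big_ord_recr /= v0 subnn v0 mul0r mulr0 add0r addr0.
move=> /eqP; rewrite addr_eq0 => /eqP vn.
suff : 0 < (-1) ^+ n.+1 * ((n.+2%:R + 2^-1) * v n.+2).
  by rewrite mulrCA pmulr_rgt0 // addr_gt0 ?ltr0n ?invr_gt0.
rewrite vn exprS mulrN mulN1r mulNr opprK mulr_sumr big_ord_recl.
have pos (i : 'I_n.+1) : 0 < (-1) ^+ n * (v (bump 0 i) * v (n.+2 - bump 0 i)%N).
  have lei := ltn_ord i; rewrite /bump leq0n add1n subSS.
  have -> : (-1) ^+ n = (-1) ^+ i * (-1) ^+ (n.+1 - i).-1 :> rat.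
    by rewrite -exprD; congr (_ ^+ _); lia.
  rewrite mulrACA mulr_gt0 ?(IH i.+1) ?(IH (n.+1 - i)%N) //; lia.
by rewrite ltr_pwDl ?pos // sumr_ge0 // => i _; rewrite ltW ?pos.
Qed.

(** * The values of the P_k at integers *)

Definition odd_fact (k : nat) : rat := \prod_(1 <= i < k.+1) (2 * i + 1)%:R.

Definition odd_superfact (k : nat) : rat := \prod_(1 <= j < k) odd_fact j.

(** The coefficients of (sqrt z coth (sqrt z) - 1) / 2, expressed through A;
[coth_coef_conv] is what identifies them as such. *)
Definition coth_coef (n : nat) : rat :=
  if n is n'.+1 then (-1) ^+ n' * A n / (2 * odd_superfact n.+1) else 0.

Lemma odd_fact_gt0 k : 0 < odd_fact k.
Proof. by apply: prodr_gt0 => i _; rewrite ltr0n addn1. Qed.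

Lemma odd_superfact_gt0 k : 0 < odd_superfact k.
Proof. by apply: prodr_gt0 => i _; apply: odd_fact_gt0. Qed.

Lemma odd_superfactS k :
  (0 < k)%N -> odd_superfact k.+1 = odd_superfact k * odd_fact k.
Proof. by move=> k0; rewrite /odd_superfact big_nat_recr. Qed.

(** At x = m + k the product in the recursion for P_(k+1) runs over the odd
numbers 2 m + 3, ..., 2 (m + k) + 1. *)
Lemma odd_factD m k :
  odd_fact (m + k) =
  odd_fact m * \prod_(1 <= i < k.+1) (2 * m%:R + 2 * i%:R + 1).
Proof.
elim: k => [|k IH]; first by rewrite addn0 big_geq // mulr1.
rewrite addnS /odd_fact big_nat_recr //= -/(odd_fact _) IH.
rewrite (big_nat_recr k.+1 1) //= mulrA; congr (_ * _).
by rewrite -addnS natrD natrM natrD; ring.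
Qed.

Lemma sinh_coefE n : sinh_coef n = (2 ^+ n * n`!%:R * odd_fact n)^-1.
Proof.
rewrite /sinh_coef; congr (_^-1).
elim: n => [|n IH]; first by rewrite /odd_fact big_geq ?mulr1.
have -> : (2 * n.+1).+1 = (2 * n).+3 by lia.
rewrite (factS (2 * n).+2) (factS (2 * n).+1) (factS n).
rewrite (natrM _ (2 * n).+3) (natrM _ (2 * n).+2) (natrM _ n.+1) IH exprS.
rewrite /odd_fact [in RHS]big_nat_recr //=.
have -> : ((2 * n).+2%:R : rat) = 2 * n.+1%:R by rewrite -natrM; congr (_%:R); lia.
have -> : (2 * n.+1 + 1)%N = (2 * n).+3 by lia.
by ring.
Qed.

Lemma P_rec_horner k m : (0 < k)%N ->
  (P k.+1).[(m + k)%:R] * (2 * m%:R)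
  = A k * (odd_fact (m + k) / odd_fact m) - odd_fact k * (P k).[(m + k)%:R].
Proof.
move=> k0; have := congr1 (horner^~ (m + k)%:R) (P_rec k0).
rewrite odd_factD [odd_fact m * _]mulrC mulfK ?gt_eqF ?odd_fact_gt0 //.
rewrite /P_num /P_den hornerM !hornerD !hornerN !hornerZ hornerX.
rewrite -polyC_natr hornerC horner_prod.
have -> : 2 * (m + k)%:R - (2 * k)%:R = 2 * m%:R :> rat.
  by rewrite natrM natrD; ring.
move=> ->; congr (_ * _ - _); apply: eq_bigr => i _.
by rewrite -!polyC_natr !hornerE natrD !natrM; ring.
Qed.

(** The identity V S = D S. The normalised value T k m of P_k at m + k satisfies
T k (m+1) - T (k+1) m = v_k / (2 (m+1) + 1)!, where both values of T belong to
the same point n = k + m + 1. Going from T 1 (n-1) = n / (2 n + 1)! to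
T n 0 = v_n telescopes to the convolution sum. *)
Lemma coth_coef_conv n :
  \sum_(i < n.+1) coth_coef i * sinh_coef (n - i) = n%:R * sinh_coef n.
Proof.
case: n => [|n]; first by rewrite big_ord1 /= !mul0r.
pose T k m : rat := (-1) ^+ k.-1 * (P k).[(m + k)%:R]
   / (2 * 2 ^+ m * odd_superfact k * odd_fact (m + k) * m`!%:R).
have fact0 m : ((m`!)%:R : rat) != 0 by rewrite pnatr_eq0 -lt0n fact_gt0.
have of0 m : odd_fact m != 0 by rewrite gt_eqF ?odd_fact_gt0.
have os0 m : odd_superfact m != 0 by rewrite gt_eqF ?odd_superfact_gt0.
have TS k m : T k.+1 m.+1 = T k.+2 m + coth_coef k.+1 * sinh_coef m.+1.
  have Pk : (P k.+1).[(m.+1 + k.+1)%:R] =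
      (A k.+1 * (odd_fact (m.+1 + k.+1) / odd_fact m.+1)
       - (P k.+2).[(m.+1 + k.+1)%:R] * (2 * m.+1%:R)) / odd_fact k.+1.
    by rewrite P_rec_horner // opprB addrC subrK mulrC mulKf.
  rewrite /T /coth_coef Pk sinh_coefE (odd_superfactS k.+1) // (factS m) (natrM _ m.+1).
  have -> : (m + k.+2 = m.+1 + k.+1)%N by lia.
  rewrite succnK !exprS -(@natr1 rat m).
  field.
  by rewrite !of0 os0 fact0 natr1 pnatr_eq0 expf_neq0.
have Tsum k : (k <= n)%N ->
  \sum_(i < k.+1) coth_coef i * sinh_coef (n.+1 - i) + T k.+1 (n - k)%N
  = n.+1%:R * sinh_coef n.+1.
  elim: k => [_|k IH ltkn].
    rewrite big_ord1 mul0r add0r subn0 /T sinh_coefE addn1 /= factS natrM.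
    rewrite /odd_superfact big_geq // hornerC exprS.
    by field; rewrite fact0 of0 nat1r pnatr_eq0 expf_neq0.
  rewrite -(IH (ltnW ltkn)) big_ord_recr /= -addrA; congr (_ + _).
  have -> : (n - k = (n - k.+1).+1)%N by lia.
  by rewrite TS addrC; congr (_ + _ * sinh_coef _); lia.
rewrite -(Tsum n) // big_ord_recr /= subnn; congr (_ + _).
rewrite /T /sinh_coef subnn add0n /= /A odd_superfactS //; field.
by rewrite !of0 !os0.
Qed.

Lemma A_gt0 k : (0 < k)%N -> 0 < A k.
Proof.
move=> k0; have v0 : coth_coef 0 = 0 by [].
have := riccati_alternating _ v0 (riccati _ v0 coth_coef_conv) _ k0.
case: k k0 => // k _ /=; rewrite !mulrA -expr2 sqrr_sign mul1r.
by rewrite pmulr_lgt0 // invr_gt0 mulr_gt0 ?odd_superfact_gt0.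
Qed.

(** * Degree and leading coefficient *)

Lemma P_denE k : P_den k = 2 *: ('X - k%:R%:P).
Proof. by rewrite /P_den scalerBr natrM -!mul_polyC !polyC_natr. Qed.

Lemma P_factorE k i :
  2 *: 'X - (2 * k)%:R + (2 * i)%:R + 1 = 2 *: ('X - (k%:R - i%:R - 2^-1)%:P)
  :> {poly rat}.
Proof.
rewrite scalerBr -!polyC_natr -mul_polyC -addrA -addrA; congr (_ + _).
rewrite -mul_polyC -polyCM -polyCN -polyC1 -!polyCD -polyCN; congr (_%:P).
by rewrite !natrM; field.
Qed.

Lemma P_prodE k :
  \prod_(1 <= i < k.+1) (2 *: 'X - (2 * k)%:R + (2 * i)%:R + 1)
  = 2 ^+ k *: \prod_(1 <= i < k.+1) ('X - (k%:R - i%:R - 2^-1)%:P) :> {poly rat}.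
Proof.
rewrite (eq_bigr _ (fun i _ => P_factorE k i)) scaler_prod.
by rewrite prodr_const_nat subn1.
Qed.

(** The degree bound makes P_k subordinate to the product in the numerator of
P_(k+1), and [A_gt0] makes the term coming from this product survive. *)
Lemma size_lead_P k : (0 < k)%N ->
  (size (P k.+1) <= k)%N /\ lead_coef (P k.+1) * 2 = A k * 2 ^+ k.
Proof.
elim: k => // k IH k0.
have sizeP : (size (P k.+1) <= k.+1)%N.
  case: k IH k0 => [|k] IH _; first by rewrite size_poly1.
  by have [/leqW] := IH isT.
move: k.+1 k0 sizeP => {IH}k k0 sizeP.
set Q := \prod_(1 <= i < k.+1) ('X - (k%:R - i%:R - 2^-1 : rat)%:P).
have sizeQ : size Q = k.+1 by rewrite size_prod_XsubC size_iota subn1.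
have Ak0 : A k * 2 ^+ k != 0.
  by rewrite mulf_neq0 ?expf_neq0 // gt_eqF ?A_gt0.
have numE : P_num k (P k) = (A k * 2 ^+ k) *: Q - odd_fact k *: P k.
  by rewrite /P_num P_prodE scalerA.
have ltP : (size (- (odd_fact k *: P k)) < size ((A k * 2 ^+ k) *: Q))%N.
  rewrite size_polyN (size_scale _ Ak0) sizeQ ltnS.
  by rewrite (leq_trans (size_scale_leq _ _)).
have rec := P_rec k0; split.
  have := erefl (size (P_num k (P k))); rewrite -{1}rec numE size_polyDl //.
  rewrite size_scale // sizeQ P_denE -scalerAr size_scale //.
  have [->|P0] := eqVneq (P k.+1) 0; first by rewrite mul0r size_poly0.
  by rewrite size_Mmonic ?monicXsubC // size_XsubC addn2 /= => -[->].
have := congr1 lead_coef rec; rewrite numE lead_coefDl // P_denE.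
rewrite lead_coefM !lead_coefZ lead_coefXsubC mulr1.
by rewrite (monicP (monic_prod_XsubC _ _ _)) mulr1.
Qed.

Theorem theorem5 (k : nat) (hk : (2 <= k)%N) :
  lead_coef (P k) = A (k - 1)%N * 2%:R ^+ (k - 2).
Proof.
case: k hk => [|[|k]] // _; rewrite !subSS !subn0.
have [_] := size_lead_P k.+1 isT.
by rewrite exprSr mulrA => /mulIf; apply.
Qed.
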